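(* Let $n\ge1$ and let $\mathfrak E^n$ be the variety of complex $n$-dimensional evolution algebras with one-dimensional square together with the trivial (zero product) algebra. Then $\mathfrak E^n$ is irreducible and the algebra $\mathbf E_n$ is rigid in $\mathfrak E^n$.
   Context: An evolution algebra is an algebra (bilinear product, not necessarily associative) having a basis $\{e_1,\dots,e_n\}$ with $e_ie_j=0$ for $i\ne j$. The square $\mathbb A^2$ is the linear span of all products. $\mathbf E_n$ is the complex algebra with basis $e_1,\dots,e_n$ and products $e_1^2=\dots=e_n^2=e_1$, $e_ie_j=0$ for $i\neq j$. Let $\mathbf V$ be an $n$-dimensional complex vector space. The algebra structures on $\mathbf V$ are the elements of $\mathrm{Hom}(\mathbf V\otimes\mathbf V,\mathbf V)\cong\mathbb C^{n^3}$ (coordinates: the structure constants in a fixed basis), with the Zariski topology. $\mathfrak E^n$ is regarded as the Zariski-closed subset of those structures $\mu$ such that $(\mathbf V,\mu)$ is either the zero-product algebra or an evolution algebra with one-dimensional square. The group $\mathrm{GL}(\mathbf V)$ acts by $(g*\mu)(x\otimes y)=g\mu(g^{-1}x\otimes g^{-1}y)$; the orbit $O(\mu)$ consists of the structures isomorphic to $\mu$. An algebra represented by $\mu\in\mathfrak E^n$ is rigid in $\mathfrak E^n$ if $O(\mu)$ is an open subset of $\mathfrak E^n$. A subset is irreducible if it cannot be represented as a union of two non-trivial (proper relatively) closed subsets. *)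

(* Defs.v *)
(* K is a general field; the complex numbers are K = R[i] with R : realType. *)
From mathcomp Require Import all_boot all_order all_algebra.
From mathcomp Require Import boolp classical_sets reals.
From mathcomp Require Import complex mpoly.

Set Implicit Arguments.
Unset Strict Implicit.
Unset Printing Implicit Defensive.

Import GRing.Theory.
Local Open Scope ring_scope.
Local Open Scope classical_set_scope.

Section Zariski.
Variables (K : fieldType) (T : finType).

(* Affine space over K with one coordinate per element of T; the variable ['X_i]
   stands for the coordinate [enum_val i]. *)
Definition zero_locus (S : set {mpoly K[#|T|]}) : set {ffun T -> K} :=
  [set w | forall p, S p -> p.@[fun i => w (enum_val i)] = 0].

Definition zariski_closed (Z : set {ffun T -> K}) : Prop :=
  exists S, Z = zero_locus S.

Definition zariski_open (U : set {ffun T -> K}) : Prop := zariski_closed (~` U).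

Definition closed_in (E A : set {ffun T -> K}) : Prop :=
  exists2 Z, zariski_closed Z & A = E `&` Z.

Definition open_in (E A : set {ffun T -> K}) : Prop :=
  exists2 U, zariski_open U & A = E `&` U.

Definition irreducible (E : set {ffun T -> K}) : Prop :=
  forall A B, closed_in E A -> closed_in E B ->
    E = A `|` B -> A = E \/ B = E.

End Zariski.

Section Algebras.
Variables (K : fieldType) (n : nat).

(* [mu (i, j, k)] is the coefficient of e_k in e_i e_j, for the standard basis
   of V = K^n. *)
Definition algebra_structure : Type := {ffun 'I_n * 'I_n * 'I_n -> K}.

Implicit Types (mu nu : algebra_structure) (x y : 'cV[K]_n) (g : 'M[K]_n).

Definition mul mu x y : 'cV[K]_n :=
  \col_k \sum_i \sum_j x i 0 * y j 0 * mu (i, j, k).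

Definition structure_of (f : 'cV[K]_n -> 'cV[K]_n -> 'cV[K]_n) :
    algebra_structure :=
  [ffun t => f (delta_mx t.1.1 0) (delta_mx t.1.2 0) t.2 0].

Definition gl_act g mu : algebra_structure :=
  structure_of (fun x y => g *m mul mu (invmx g *m x) (invmx g *m y)).

Definition orbit mu : set algebra_structure :=
  [set nu | exists2 g, g \in unitmx & nu = gl_act g mu].

Definition evolution_algebra mu : Prop :=
  exists2 e : n.-tuple 'cV[K]_n, basis_of fullv e &
    forall i j : 'I_n, i != j -> mul mu (tnth e i) (tnth e j) = 0.

(* U is the linear span of all products, i.e. the least subspace containing
   them. *)
Definition is_square mu (U : {vspace 'cV[K]_n}) : Prop :=
  (forall x y, mul mu x y \in U) /\
  (forall W : {vspace 'cV[K]_n}, (forall x y, mul mu x y \in W) -> (U <= W)%VS).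

Definition one_dim_square mu : Prop :=
  exists2 U : {vspace 'cV[K]_n}, is_square mu U & \dim U = 1%N.

Definition zero_product mu : Prop := forall x y, mul mu x y = 0.

Definition evolution_variety : set algebra_structure :=
  [set mu | zero_product mu \/ (evolution_algebra mu /\ one_dim_square mu)].

Definition rigid_in (E : set algebra_structure) mu : Prop :=
  E mu /\ open_in E (orbit mu).

(* e_i e_i = e_1 and e_i e_j = 0 for i <> j; e_1 has index 0. *)
Definition algE : algebra_structure :=
  [ffun t : 'I_n * 'I_n * 'I_n =>
     ((t.1.1 == t.1.2) && (t.2 == 0%N :> nat))%:R].

Lemma mul_delta mu (i j k : 'I_n) :
  mul mu (delta_mx i 0) (delta_mx j 0) k 0 = mu (i, j, k).
Proof.
rewrite mxE (bigD1 i) //= (bigD1 j) //= !mxE !eqxx !mul1r.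
rewrite big1 => [|b /negPf nb]; last by rewrite !mxE nb mulr0 mul0r.
rewrite big1 ?addr0 // => a /negPf na.
by rewrite big1 // => b _; rewrite !mxE na !mul0r.
Qed.

Lemma mul_sum mu x y :
  mul mu x y =
  \sum_i \sum_j (x i 0 * y j 0) *: mul mu (delta_mx i 0) (delta_mx j 0).
Proof.
apply/colP=> k; rewrite mxE summxE; apply: eq_bigr => i _.
by rewrite summxE; apply: eq_bigr => j _; rewrite mxE mul_delta.
Qed.

Lemma mul_is_bilinear mu a x x' y y' :
  mul mu (a *: x + x') y = a *: mul mu x y + mul mu x' y /\
  mul mu x (a *: y + y') = a *: mul mu x y + mul mu x y'.
Proof.
split; apply/colP=> k; rewrite !mxE mulr_sumr -big_split /=;
  apply: eq_bigr => i _; rewrite mulr_sumr -big_split /=;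
  apply: eq_bigr => j _; rewrite !mxE.
  by rewrite !mulrDl !mulrA.
by rewrite mulrDr mulrDl !mulrA (mulrC _ a).
Qed.

Lemma mul_gl_act g mu x y :
  mul (gl_act g mu) x y = g *m mul mu (invmx g *m x) (invmx g *m y).
Proof.
pose h u v := g *m mul mu (invmx g *m u) (invmx g *m v).
have hl v a u u' : h (a *: u + u') v = a *: h u v + h u' v.
  by rewrite /h mulmxDr -scalemxAr (mul_is_bilinear _ _ _ _ _ 0).1 mulmxDr -scalemxAr.
have hr u a v v' : h u (a *: v + v') = a *: h u v + h u v'.
  by rewrite /h mulmxDr -scalemxAr (mul_is_bilinear _ _ _ 0 _ _).2 mulmxDr -scalemxAr.
have lin_sum (f : 'cV[K]_n -> 'cV[K]_n) :
    (forall a u v, f (a *: u + v) = a *: f u + f v) ->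
    forall u, f u = \sum_i u i 0 *: f (delta_mx i 0).
  move=> fl u; have f0 : f 0 = 0.
    have := fl 1 0 0; rewrite !scale1r addr0 => /esym/eqP.
    by rewrite -subr_eq0 addrK => /eqP.
  rewrite [in LHS](matrix_sum_delta u).
  transitivity (f (\sum_i u i 0 *: delta_mx i 0)).
    by congr f; apply: eq_bigr => i _; rewrite big_ord1.
  by elim/big_rec2: _ => // i _ w _ <-; rewrite fl.
rewrite -/(h x y) mul_sum (lin_sum (h^~ y) (hl y)); apply: eq_bigr => i _.
rewrite (lin_sum _ (hr _)) scaler_sumr; apply: eq_bigr => j _.
by rewrite scalerA; congr (_ *: _); apply/colP=> k; rewrite mul_delta ffunE.
Qed.

End Algebras.

Arguments evolution_variety K n : clear implicits.

(* Main.v *)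
(* The variety is exactly the set of products (x, y) |-> B(x, y) v with B a
   symmetric bilinear form and v a vector, since symmetric forms over an
   algebraically closed field of characteristic 0 are diagonalizable. Any two
   such products are joined by the polynomial curve obtained by moving B and v
   along lines, whence irreducibility. The trace of left multiplication by
   B(x, y) v is B(x, y) B(v, v), so the determinant of this trace form is nonzero
   exactly when B is nondegenerate and B(v, v) <> 0; after rescaling, v then
   extends to a B-orthonormal basis, so this open condition cuts out the orbit
   of E_n. *)
Require Import Defs.
From mathcomp Require Import all_boot all_order all_algebra.
From mathcomp Require Import boolp classical_sets reals.
From mathcomp Require Import complex mpoly.

Set Implicit Arguments.
Unset Strict Implicit.
Unset Printing Implicit Defensive.

Import GRing.Theory Num.Theory.
Local Open Scope ring_scope.
Local Open Scope classical_set_scope.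

(** * Irreducibility by polynomial curves *)

Section Zariski.
Variables (K : numFieldType) (T : finType).

(** Characteristic 0 makes the [size p] naturals in [s] distinct, one more than the degree of
    [p]. *)
Lemma poly_nonroot (p : {poly K}) : p != 0 -> exists t, p.[t] != 0.
Proof.
move=> p0; apply: contrapT => nt.
pose s : seq K := [seq i%:R | i <- iota 0 (size p)].
have us : uniq s.
  by rewrite map_inj_uniq ?iota_uniq // => i j /eqP; rewrite eqr_nat => /eqP.
have rs : all (root p) s.
  apply/allP => _ /mapP[i _ ->]; apply/negPn/negP => h.
  by apply: nt; exists i%:R.
by have := max_poly_roots p0 rs us; rewrite size_map size_iota ltnn.
Qed.

(** [mmap polyC] restricts [p] to the curve with coordinates [c], as a polynomial in the
    parameter. *)
Lemma horner_mmap_polyC (p : {mpoly K[#|T|]}) (c : T -> {poly K}) t :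
  (mmap polyC (fun i => c (enum_val i)) p).[t] =
  p.@[fun i => (c (enum_val i)).[t]].
Proof.
rewrite /meval /mmap horner_sum; apply: eq_bigr => m _.
rewrite hornerM hornerC; congr (_ * _).
rewrite /mmap1 horner_prod; apply: eq_bigr => i _.
by rewrite horner_exp.
Qed.

(* The product of two polynomials that do not vanish on the curve [c] is a
   nonzero polynomial in the parameter of [c]. *)
Lemma curve_connected_irreducible (E : set {ffun T -> K}) :
  (forall w1 w2, E w1 -> E w2 -> exists c : T -> {poly K},
    [/\ forall t, E [ffun i => (c i).[t]],
        w1 = [ffun i => (c i).[0]] & w2 = [ffun i => (c i).[1]]]) ->
  irreducible E.
Proof.
move=> cE A B [_ [S1 ->] defA] [_ [S2 ->] defB] defE.
have nonvan (S : set {mpoly K[#|T|]}) : E `&` zero_locus S <> E ->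
    exists w p, [/\ E w, S p & p.@[fun i => w (enum_val i)] != 0].
  move=> neE; apply: contrapT => nw; apply: neE; apply/seteqP; split=> w /=.
    by case.
  move=> Ew; split=> // p Sp; apply/eqP/negPn/negP => pw.
  by apply: nw; exists w, p.
apply: contrapT => /not_orP [].
rewrite {1}defA {1}defB => /nonvan [w1 [p1 [E1 Sp1 n1]]] /nonvan [w2 [p2 [E2 Sp2 n2]]].
have [c [cin def1 def2]] := cE _ _ E1 E2.
have evc (p : {mpoly K[#|T|]}) t : p.@[fun i => [ffun i => (c i).[t]] (enum_val i)] =
    (mmap polyC (fun i => c (enum_val i)) p).[t].
  by rewrite (horner_mmap_polyC p c t); apply: meval_eq => i; rewrite ffunE.
pose f (p : {mpoly K[#|T|]}) := mmap polyC (fun i => c (enum_val i)) p.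
have f0 p t : (f p).[t] != 0 -> f p != 0.
  by apply: contra_neq => ->; rewrite horner0.
have /poly_nonroot [t] : f p1 * f p2 != 0.
  rewrite mulf_neq0 //; [apply: (f0 _ 0)|apply: (f0 _ 1)].
    by rewrite -evc -def1.
  by rewrite -evc -def2.
rewrite hornerM mulf_eq0 -!evc; have := cin t; rewrite {1}defE defA defB.
by move=> [] [_ /(_ _)] h; [rewrite (h _ Sp1) eqxx|rewrite (h _ Sp2) eqxx orbT].
Qed.

End Zariski.

(** * Congruence of symmetric matrices *)

Section Congruence.
Variable K : numClosedFieldType.

(** As [u] has rank 1, it is the first column of [col_ebase u] times the nonzero scalar [c];
    absorbing [c] into the invertible matrix gives [P]. *)
Lemma unitmx_first_col m (u : 'cV[K]_(1 + m)) : u != 0 ->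
  exists2 P, P \in unitmx & lsubmx P = u.
Proof.
move=> u0; have r1 : \rank u = 1%N.
  by apply/eqP; rewrite eqn_leq rank_leq_col lt0n mxrank_eq0.
pose c := row_ebase u 0 0.
have c0 : c != 0.
  by have := row_ebase_unit u; rewrite unitmxE det_mx11 unitfE.
exists (c *: col_ebase u).
  by rewrite unitmxZ ?unitfE // col_ebase_unit.
rewrite -[RHS](mulmx_ebase u) r1 [row_ebase u]mx11_scalar -/c mul_mx_scalar.
rewrite linearZ; congr (_ *: _).
rewrite -{2}[col_ebase u]hsubmxK.
have -> : pid_mx 1 = col_mx 1%:M 0 :> 'M[K]_(1 + m, 1).
  apply/colP=> i; rewrite !mxE; case: splitP => j ij; rewrite ?ord1 !mxE.
    by rewrite ij !ord1.
  by rewrite ij.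
by rewrite mul_row_col mulmx1 mulmx0 addr0.
Qed.

Lemma sym_mulmx n (B P : 'M[K]_n) : B^T = B -> (P^T *m B *m P)^T = P^T *m B *m P.
Proof. by move=> sB; rewrite !trmx_mul trmxK sB mulmxA. Qed.

(** One Gram-Schmidt step: [u] is completed to a basis, whose other vectors are then made orthogonal
    to [u]; this divides by the value of the form at [u]. *)
Lemma split_vector m (B : 'M[K]_(1 + m)) u : B^T = B ->
  (u^T *m B *m u) 0 0 != 0 ->
  exists P, exists2 C,
    [/\ P \in unitmx, lsubmx P = u & C^T = C] &
    P^T *m B *m P = block_mx (u^T *m B *m u) 0 0 C.
Proof.
move=> sB a0.
have u0 : u != 0 by apply: contra_neq a0 => ->; rewrite mulmx0 mxE.
have [P uP Pu] := unitmx_first_col u0.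
set a := (_ *m _ *m _) 0 0 in a0; set A := P^T *m B *m P.
have defA : ulsubmx A = a%:M.
  rewrite -mx11_scalar -Pu /A -{1 2}[P]hsubmxK tr_row_mx !mul_col_mx.
  by rewrite /ulsubmx col_mxKu mul_mx_row row_mxKl.
have sA : A^T = A by apply: sym_mulmx.
pose r := ursubmx A; have dlA : dlsubmx A = r^T by rewrite -{1}sA trmx_ursub.
(* [L] subtracts from each later basis vector its projection onto [u] and leaves the first column
   alone. *)
pose L : 'M[K]_(1 + m) := block_mx 1%:M (- a^-1 *: r) 0 1%:M.
have uL : L \in unitmx by rewrite unitmxE det_ublock !det1 mulr1 unitr1.
pose C := drsubmx (L^T *m A *m L).
have defC : (P *m L)^T *m B *m (P *m L) = L^T *m A *m L.
  by rewrite trmx_mul /A !mulmxA.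
exists (P *m L), C.
  split; first by rewrite unitmx_mul uP.
    rewrite -[P]hsubmxK mul_row_block mulmx1 mulmx0 addr0 row_mxKl //.
  by rewrite /C trmx_drsub sym_mulmx.
rewrite defC -[LHS]submxK; congr block_mx.
- rewrite /L -[A]submxK tr_block_mx !mulmx_block block_mxKul.
  by rewrite !trmx1 !trmx0 !mul1mx !mul0mx !mulmx1 !mulmx0 !addr0 defA -mx11_scalar.
- rewrite /L -[A]submxK tr_block_mx !mulmx_block block_mxKur.
  rewrite !trmx1 !trmx0 !mul1mx !mul0mx !mulmx1 !addr0 defA.
  by rewrite mul_scalar_mx scalerA mulrN divff // scaleN1r addNr.
- rewrite /L -[A]submxK tr_block_mx !mulmx_block block_mxKdl.
  rewrite trmx1 mul1mx mulmx1 mulmx0 addr0 defA dlA.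
  by rewrite mul_mx_scalar linearZ scalerA mulrN divff // scaleN1r addNr.
Qed.

Lemma bilin_delta n (B : 'M[K]_n) i j :
  ((delta_mx i 0 : 'cV_n)^T *m B *m (delta_mx j 0 : 'cV_n)) 0 0 = B i j.
Proof. by rewrite trmx_delta -rowE -colE !mxE. Qed.

(** Polarization: if the form vanishes on every vector, expanding it at [e_i + e_j] leaves twice
    [B i j], and 2 is nonzero in [K]. *)
Lemma anisotropic_vector n (B : 'M[K]_n) : B^T = B -> B != 0 ->
  exists u : 'cV_n, (u^T *m B *m u) 0 0 != 0.
Proof.
move=> sB; apply: contra_neqP => /forallNP iso; apply/matrixP=> i j.
have {}iso (u : 'cV[K]_n) : (u^T *m B *m u) 0 0 = 0 by apply/eqP/negPn/negP; exact: iso.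
have := iso (delta_mx i 0 + delta_mx j 0).
rewrite [(_ + _)^T]linearD !mulmxDl !mulmxDr.
rewrite ![((_ + _ : 'M__) 0 0)]mxE !iso add0r addr0 !bilin_delta.
rewrite -[in B j i]sB !mxE -mulr2n => /eqP.
by rewrite mulrn_eq0 => /eqP.
Qed.

(** Induction on the size: an anisotropic vector splits off a 1 by 1 block, and the complement [C]
    is again symmetric. *)
Lemma congruent_diag n (B : 'M[K]_n) : B^T = B ->
  exists2 P, P \in unitmx & exists d, P^T *m B *m P = diag_mx d.
Proof.
elim: n B => [|m IHm] B sB.
  by exists 1%:M; [exact: unitmx1|exists 0; apply/matrixP => -[]].
have [->|/(anisotropic_vector sB) [u u0]] := eqVneq B 0.
  exists 1%:M; first exact: unitmx1.
  by exists 0; rewrite mulmx0 mul0mx; apply/matrixP=> i j; rewrite !mxE mul0rn.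
have [P [C [uP _ sC] defC]] := @split_vector m B u sB u0.
have [Q uQ [d defd]] := IHm C sC.
pose G : 'M[K]_(1 + m) := block_mx 1%:M 0 0 Q.
have uG : G \in unitmx by rewrite unitmxE det_ublock det1 mul1r -unitmxE.
exists (P *m G); first by rewrite unitmx_mul uP.
pose a := u^T *m B *m u; exists (row_mx a d).
have -> : (P *m G)^T *m B *m (P *m G) = G^T *m (P^T *m B *m P) *m G.
  by rewrite trmx_mul !mulmxA.
rewrite defC tr_block_mx !mulmx_block.
rewrite !trmx1 !trmx0 !mul1mx !mulmx1 !mulmx0 !addr0 !mul0mx !add0r
  mul0mx defd.
apply: etrans (esym (diag_mx_row a d)); congr block_mx; rewrite [LHS]mx11_scalar.
by apply/matrixP => i j; rewrite !mxE !ord1.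
Qed.

(** Invertibility makes the diagonal entries nonzero, so each basis vector can be divided by a
    square root, supplied by algebraic closure. *)
Lemma congruent_unit n (B : 'M[K]_n) : B^T = B -> B \in unitmx ->
  exists2 P, P \in unitmx & P^T *m B *m P = 1%:M.
Proof.
move=> sB uB; have [P uP [d defd]] := congruent_diag sB.
have d0 i : d 0 i != 0.
  have : diag_mx d \in unitmx by rewrite -defd !unitmx_mul unitmx_tr uP uB.
  by rewrite unitmxE det_diag unitfE => /prodf_neq0/(_ i isT).
pose s : 'rV[K]_n := \row_i (sqrtC (d 0 i))^-1.
exists (P *m diag_mx s).
  rewrite unitmx_mul uP unitmxE det_diag unitfE; apply/prodf_neq0 => i _.
  by rewrite mxE invr_eq0 sqrtC_eq0.
have -> : (P *m diag_mx s)^T *m B *m (P *m diag_mx s) =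
    diag_mx s *m (P^T *m B *m P) *m diag_mx s.
  by rewrite trmx_mul tr_diag_mx !mulmxA.
rewrite defd !mulmx_diag -diag_const_mx; congr diag_mx; apply/rowP => i.
by rewrite !mxE -[X in _ * X * _]sqrtCK expr2 mulKf ?divff // sqrtC_eq0.
Qed.

(** Splitting off [v] first and normalizing only on its orthogonal complement keeps [v] as the first
    column. *)
Lemma congruent_unit_first m (B : 'M[K]_(1 + m)) v : B^T = B ->
  B \in unitmx -> v^T *m B *m v = 1%:M ->
  exists P, [/\ P \in unitmx, lsubmx P = v & P^T *m B *m P = 1%:M].
Proof.
move=> sB uB v1.
have [|P [C [uP Pv sC] defC]] := @split_vector m B v sB.
  by rewrite v1 mxE eqxx oner_eq0.
have uC : C \in unitmx.
  have : P^T *m B *m P \in unitmx by rewrite !unitmx_mul unitmx_tr uP uB.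
  by rewrite defC v1 unitmxE det_ublock det1 mul1r -unitmxE.
have [Q uQ Q1] := congruent_unit sC uC.
pose G : 'M[K]_(1 + m) := block_mx 1%:M 0 0 Q.
have uG : G \in unitmx by rewrite unitmxE det_ublock det1 mul1r -unitmxE.
exists (P *m G); split; first by rewrite unitmx_mul uP.
  by rewrite -[P]hsubmxK mul_row_block mulmx1 mulmx0 addr0 row_mxKl.
have -> : (P *m G)^T *m B *m (P *m G) = G^T *m (P^T *m B *m P) *m G.
  by rewrite trmx_mul !mulmxA.
rewrite defC v1 tr_block_mx !mulmx_block.
rewrite !trmx1 !trmx0 !mul1mx !mulmx1 !mulmx0 !addr0 !mul0mx !add0r.
by rewrite mul0mx Q1 -scalar_mx_block.
Qed.

End Congruence.

(** * Products of the form B(x, y) v *)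

Section RankOne.
Variables (K : numClosedFieldType) (n : nat).
Implicit Types (mu nu : algebra_structure K n) (x y v : 'cV[K]_n) (B g : 'M[K]_n).

Definition tensor B v : algebra_structure K n :=
  [ffun t => B t.1.1 t.1.2 * v t.2 0].

Lemma mul_tensor B v x y : Defs.mul (tensor B v) x y = (x^T *m B *m y) 0 0 *: v.
Proof.
apply/colP=> k; rewrite !mxE mulr_suml exchange_big; apply: eq_bigr => j _ /=.
rewrite !mxE !mulr_suml; apply: eq_bigr => i _.
by rewrite !mxE ffunE /= mulrA; congr (_ * _); rewrite mulrAC.
Qed.

Lemma mul_inj mu nu :
  (forall i j, Defs.mul mu (delta_mx i 0) (delta_mx j 0) =
               Defs.mul nu (delta_mx i 0) (delta_mx j 0)) -> mu = nu.
Proof.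
by move=> h; apply/ffunP => -[[i j] k]; rewrite -!mul_delta h.
Qed.

Lemma gl_act_tensor g B v :
  gl_act g (tensor B v) = tensor ((invmx g)^T *m B *m invmx g) (g *m v).
Proof.
apply: mul_inj => i j; rewrite mul_gl_act !mul_tensor -scalemxAr.
by rewrite trmx_mul !mulmxA.
Qed.

Lemma basis_of_unitmx g : g \in unitmx -> basis_of fullv [tuple col i g | i < n].
Proof.
move=> ug; rewrite basisEdim size_tuple dimvf /dim /= muln1 leqnn andbT.
apply/subvP => x _; rewrite -[x](mulKVmx ug).
have -> : g *m (invmx g *m x) = \sum_i (invmx g *m x) i 0 *: col i g.
  by apply/colP=> k; rewrite mxE summxE; apply: eq_bigr => i _; rewrite !mxE mulrC.
apply: memv_suml => i _; apply: memvZ; apply: memv_span.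
by apply/mapP; exists i; rewrite ?mem_enum.
Qed.

Lemma tensor_evolution B v : B^T = B -> evolution_variety K n (tensor B v).
Proof.
move=> sB.
have [->|B0] := eqVneq B 0.
  by left=> x y; rewrite mul_tensor mulmx0 mul0mx mxE scale0r.
have [->|v0] := eqVneq v 0; first by left=> x y; rewrite mul_tensor scaler0.
right; split.
  (* The columns of a diagonalizing [P] are B-orthogonal, so distinct ones multiply to 0. *)
  have [P uP [d defd]] := congruent_diag sB.
  exists [tuple col i P | i < n]; first exact: basis_of_unitmx.
  move=> i j ij; rewrite !tnth_mktuple mul_tensor.
  rewrite !colE trmx_mul !mulmxA -(mulmxA _ P^T) -(mulmxA _ _ P) defd.
  by rewrite bilin_delta mxE (negPf ij) scale0r.
exists <[v]>%VS; last by rewrite dim_vline v0.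
split=> [x y|W hW]; first by rewrite mul_tensor memvZ ?memv_line.
(* A nonzero entry of [B] makes [v] a multiple of a product, so [W] must contain [v]. *)
have [i [j bij]] : exists i j, B i j != 0.
  apply: contrapT => nB; move/eqP: B0; apply; apply/matrixP => i j.
  by rewrite mxE; apply/eqP/negPn/negP => h; apply: nB; exists i, j.
have := hW (delta_mx i 0) (delta_mx j 0).
by rewrite mul_tensor bilin_delta -memvE rpredZeq (negPf bij).
Qed.

Lemma mul_suml mu (a : 'I_n -> K) (u : 'I_n -> 'cV[K]_n) y :
  Defs.mul mu (\sum_i a i *: u i) y = \sum_i a i *: Defs.mul mu (u i) y.
Proof.
elim/big_rec2: _ => [|i w z _ <-]; last first.
  by rewrite (mul_is_bilinear mu _ _ _ y 0).1.
apply/colP=> k; rewrite !mxE big1 // => i _; rewrite big1 // => j _.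
by rewrite !mxE !mul0r.
Qed.

Lemma mul_sumr mu (a : 'I_n -> K) (u : 'I_n -> 'cV[K]_n) x :
  Defs.mul mu x (\sum_i a i *: u i) = \sum_i a i *: Defs.mul mu x (u i).
Proof.
elim/big_rec2: _ => [|i w z _ <-]; last first.
  by rewrite (mul_is_bilinear mu _ x 0 _ _).2.
apply/colP=> k; rewrite !mxE big1 // => i _; rewrite big1 // => j _.
by rewrite !mxE mulr0 mul0r.
Qed.

(** In the basis [e] only squares of basis vectors contribute, whatever the order of the factors. *)
Lemma evolution_mulC mu : evolution_algebra mu ->
  forall x y, Defs.mul mu x y = Defs.mul mu y x.
Proof.
move=> [e be orth] x y.
rewrite (coord_basis be (memvf x)) (coord_basis be (memvf y)) !mul_suml.
under eq_bigr do rewrite mul_sumr scaler_sumr.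
under [RHS]eq_bigr do rewrite mul_sumr scaler_sumr.
rewrite exchange_big; apply: eq_bigr => j _; apply: eq_bigr => i _.
rewrite !scalerA mulrC; congr (_ *: _); rewrite -!tnth_nth.
by have [->//|ij] := eqVneq i j; rewrite !orth // eq_sym.
Qed.

(** In the nonzero case [v] spans the square and [B] collects the coefficients along [v] of products
    of standard basis vectors; commutativity makes [B] symmetric because [v] is nonzero. *)
Lemma evolution_tensor mu : evolution_variety K n mu ->
  exists2 B, B^T = B & exists v, mu = tensor B v.
Proof.
move=> [zmu|[evo [U [sqU _] dU]]].
  exists 0; first exact: trmx0.
  by exists 0; apply: mul_inj => i j; rewrite zmu mul_tensor scaler0.
pose v := vpick U.
have v0 : v != 0 by rewrite vpick0 -dimv_eq0 dU.
have defU : U = <[v]>%VS.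
  by apply/esym/eqP; rewrite eqEdim -memvE memv_pick dU dim_vline v0.
have hB (t : 'I_n * 'I_n) : {b | Defs.mul mu (delta_mx t.1 0) (delta_mx t.2 0) = b *: v}.
  by apply: cid; apply/vlineP; rewrite -defU.
pose B := \matrix_(i, j) sval (hB (i, j)).
have muB : mu = tensor B v.
  apply: mul_inj => i j; rewrite mul_tensor bilin_delta mxE.
  exact: svalP (hB (i, j)).
exists B; last by exists v.
apply/matrixP => i j; rewrite mxE -(bilin_delta B j i) -(bilin_delta B i j).
have := evolution_mulC evo (delta_mx j 0) (delta_mx i 0).
rewrite muB !mul_tensor => e.
by apply/eqP; rewrite -subr_eq0 -[_ == 0]orbF -(negPf v0) -scaler_eq0 scalerBl e subrr.
Qed.

Lemma evolution_irreducible : irreducible (evolution_variety K n).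
Proof.
apply: curve_connected_irreducible => ? ?.
move=> /evolution_tensor [B1 s1 [v1 ->]] /evolution_tensor [B2 s2 [v2 ->]].
pose line (a b : K) : {poly K} := a%:P + (b - a) *: 'X.
have lineE a b t : (line a b).[t] = a + (b - a) * t.
  by rewrite !hornerE.
exists (fun t => line (B1 t.1.1 t.1.2) (B2 t.1.1 t.1.2) * line (v1 t.2 0) (v2 t.2 0)).
split=> [t| |].
- have -> : [ffun i => (line (B1 i.1.1 i.1.2) (B2 i.1.1 i.1.2) *
        line (v1 i.2 0) (v2 i.2 0)).[t]] =
      tensor (B1 + t *: (B2 - B1)) (v1 + t *: (v2 - v1)).
    by apply/ffunP => i; rewrite !ffunE hornerM !lineE !mxE ![t * _]mulrC.
  (* Symmetry persists along the line; where the form or the vector vanishes, the curve meets the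
     zero product, which belongs to the variety. *)
  by apply: tensor_evolution; rewrite linearD linearZ linearB /= s1 s2.
- by apply/ffunP => i; rewrite !ffunE hornerM !lineE !mulr0 !addr0.
- by apply/ffunP => i; rewrite !ffunE hornerM !lineE !mulr1 !subrKC.
Qed.

End RankOne.

(** * The trace form and the orbit of E_n *)

Section Rigidity.
Variable K : numClosedFieldType.

(* Entry (i, j) is the trace of left multiplication by [e_i e_j]. *)
Definition trace_form (R : comNzRingType) n (c : 'I_n * 'I_n * 'I_n -> R) : 'M[R]_n :=
  \matrix_(i, j) \sum_l c (i, j, l) * \sum_k c (l, k, k).

(** Left multiplication by [v] is the map sending z to B(v, z) v, whose trace is B(v, v). *)
Lemma trace_form_tensor n (B : 'M[K]_n) v :
  trace_form (tensor B v) = (v^T *m B *m v) 0 0 *: B.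
Proof.
apply/matrixP => i j; rewrite !mxE mulr_suml.
under [RHS]eq_bigr do rewrite mxE !mulr_suml.
rewrite exchange_big; apply: eq_bigr => l _ /=.
rewrite mulr_sumr; apply: eq_bigr => k _; rewrite !ffunE mxE /=.
by rewrite mulrC !mulrA [LHS]mulrC !mulrA.
Qed.

(** The trace form makes sense over any nonzero commutative ring; taken at indeterminate structure
    constants, its determinant is the polynomial [p] whose nonvanishing defines the set. *)
Lemma det_trace_form_open n :
  zariski_open [set mu : algebra_structure K n | \det (trace_form mu) != 0].
Proof.
pose p := \det (trace_form
  (fun t : 'I_n * 'I_n * 'I_n => 'X_(enum_rank t) : {mpoly K[#|{: 'I_n * 'I_n * 'I_n}|]})).
have evp (mu : algebra_structure K n) : p.@[fun i => mu (enum_val i)] = \det (trace_form mu).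
  rewrite /p -det_map_mx; congr (\det _); apply/matrixP => i j.
  rewrite !mxE raddf_sum; apply: eq_bigr => l _ /=.
  rewrite mevalM mevalXU enum_rankK raddf_sum; congr (_ * _).
  by apply: eq_bigr => k _ /=; rewrite mevalXU enum_rankK.
exists [set p]; apply/seteqP; split=> mu /=.
  by move=> /negP/negPn/eqP det0 _ ->; rewrite evp.
by move=> /(_ p erefl); rewrite evp => ->; rewrite eqxx.
Qed.

Lemma algE_tensor m : algE K m.+1 = tensor 1%:M (delta_mx 0 0).
Proof.
apply/ffunP => -[[i j] k]; rewrite !ffunE !mxE /= andbT -natrM mulnb.
by [].
Qed.

Lemma orbit_algE m : Defs.orbit (algE K m.+1) =
  evolution_variety K m.+1 `&` [set mu | \det (trace_form mu) != 0].
Proof.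
rewrite algE_tensor; apply/seteqP; split=> mu.
  move=> [g ug ->]; rewrite gl_act_tensor mulmx1.
  (* The transported form [h^T *m h] takes the value 1 at the transported vector g e_1, so the
     determinant is the square of [\det h]. *)
  set h := invmx g; split=> /=.
    by apply: tensor_evolution; rewrite trmx_mul trmxK.
  rewrite trace_form_tensor trmx_mul -!mulmxA (mulKmx ug) -/h.
  rewrite (mulmxA g^T) -trmx_mul mulVmx // trmx1 mul1mx.
  rewrite trmx_delta mul_delta_mx mxE eqxx scale1r.
  by rewrite det_mulmx det_tr mulf_neq0 // -unitfE -unitmxE unitmx_inv.
case=> /evolution_tensor [B sB [v ->]] /=.
rewrite trace_form_tensor; set a := (_ *m _ *m _) 0 0.
(* The exponent [m.+1] of [a] is positive, so nonvanishing also forces [a] to be nonzero. *)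
rewrite detZ mulf_eq0 expf_eq0 /= negb_or -(unitfE (\det B)) -unitmxE => /andP[a0 uB].
(* Passing from (B, v) to (a B, a^-1 v) keeps the product and turns the value [a] into a a^-2 a =
   1. *)
have [||| P [uP Pv P1]] := @congruent_unit_first K m (a *: B) (a^-1 *: v).
- by rewrite linearZ /= sB.
- by rewrite unitmxZ ?unitfE.
- rewrite [(_ *: _)^T]linearZ /= -!(scalemxAl, scalemxAr) [v^T *m B *m v]mx11_scalar -/a.
  by rewrite !scalerA mulVf // mulr1 scale_scalar_mx mulVf.
(* [P] sends e_1 to a^-1 v and carries the standard form to a B, hence E_n to the given
   structure. *)
exists P => //; rewrite gl_act_tensor mulmx1.
have -> : (invmx P)^T *m invmx P = a *: B.
  by rewrite -{2}[invmx P]mul1mx -P1 !mulmxA -trmx_mul mulmxV // trmx1 mul1mx mulmxK.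
have -> : P *m delta_mx 0 0 = a^-1 *: v.
  by rewrite -colE -Pv; apply/colP => i; rewrite !mxE; congr (P _ _); apply: val_inj.
by apply/ffunP => i; rewrite !ffunE !mxE mulrACA divff // mul1r.
Qed.

Lemma algE_rigid m : rigid_in (evolution_variety K m.+1) (algE K m.+1).
Proof.
split; first by rewrite algE_tensor; apply: tensor_evolution; apply: trmx1.
by exists [set mu | \det (trace_form mu) != 0]; [exact: det_trace_form_open|exact: orbit_algE].
Qed.

End Rigidity.

Theorem theorem39 (R : realType) (n : nat) (hn : (1 <= n)%N) :
  irreducible (evolution_variety R[i] n) /\
  rigid_in (evolution_variety R[i] n) (algE R[i] n).
Proof.
split; first exact: evolution_irreducible.
by case: n hn => // m _; apply: algE_rigid.
Qed.
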